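(* Let $A\in\mathbb{R}^{n\times n}$ be symmetric, $B\in\mathbb{R}^{n\times n}$ symmetric positive semi-definite, $\alpha>0$, and $c,f\in\mathbb{R}^n$. Suppose that $\bar y^*=(\bar\varsigma,\bar\sigma)=(\bar\varsigma,\bar\sigma_1,\bar\sigma_2)\in S^+_\sharp$ is a critical point of the dual function $\Pi^d(\varsigma,\sigma)$. Then $\bar y^*$ is a global maximizer of $\Pi^d$ on $S^+_\sharp$. Moreover, let $$(\bar x,\bar v)=\left(G(\bar\varsigma,\bar\sigma_1)^{-1}c,\ \tfrac12(f+\bar\sigma_1+\bar\sigma_2)\oslash\bar\sigma_2\right).$$ Then $(\bar x,\bar v)$ is a global minimum point of $P(x,v)$ on $\chi_v$ (i.e. a global solution of $(\mathcal{P}_b)$), and $$P(\bar x,\bar v)=\min_{(x,v)\in\chi_v}P(x,v)=\max_{(\varsigma,\sigma)\in S^+_\sharp}\Pi^d(\varsigma,\sigma)=\Pi^d(\bar\varsigma,\bar\sigma).$$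
   Context: Primal problem $(\mathcal{P}_b)$: minimize $P(x,v)=\frac12x^TAx-c^Tx+\frac12\left(\frac12x^TBx-\alpha\right)^2-f^Tv$ over $\chi_v=\{(x,v)\in\mathbb{R}^n\times\{0,1\}^n : -v\le x\le v\}$ (vector inequalities componentwise). Notation: $t\oslash s$ is the componentwise quotient $(t_i/s_i)_i$; $\mathrm{Diag}(s)$ is the diagonal matrix with diagonal $s$. For $\varsigma\in\mathbb{R}$ and $\sigma=(\sigma_1,\sigma_2)\in\mathbb{R}^n\times\mathbb{R}^n$ put $G(\varsigma,\sigma_1)=A+\varsigma B+2\,\mathrm{Diag}(\sigma_1)$. $S^+_\sharp=\{(\varsigma,\sigma)\in\mathbb{R}\times\mathbb{R}^{2n} : \varsigma\ge-\alpha,\ \sigma_1\ge0,\ \sigma_2>0,\ G(\varsigma,\sigma_1)\succ0\}$ ($\succ0$ means positive definite). Canonical dual function (defined and smooth wherever $G(\varsigma,\sigma_1)\succ0$ and $\sigma_2>0$): $$\Pi^d(\varsigma,\sigma)=-\tfrac12c^TG(\varsigma,\sigma_1)^{-1}c-\tfrac14\sum_{i=1}^n\frac{\left(f_i+(\sigma_1)_i+(\sigma_2)_i\right)^2}{(\sigma_2)_i}-\tfrac12\varsigma^2-\alpha\varsigma.$$ A critical point of $\Pi^d$ is a point where its gradient with respect to $(\varsigma,\sigma_1,\sigma_2)$ vanishes. *)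

(* Defs.v *)
From HB Require Import structures.
From mathcomp Require Import all_boot all_order all_algebra.
From mathcomp Require Import all_classical all_reals all_analysis.

Set Implicit Arguments.
Unset Strict Implicit.
Unset Printing Implicit Defensive.

Import Order.TTheory GRing.Theory Num.Theory.
Import numFieldNormedType.Exports.

Local Open Scope classical_set_scope.
Local Open Scope ring_scope.

Definition dotv (R : realType) (n : nat) (u w : 'cV[R]_n) : R :=
  (u^T *m w) 0 0.

Definition possemidefmx (R : realType) (n : nat) (M : 'M[R]_n) : Prop :=
  M^T = M /\ forall x : 'cV[R]_n, 0 <= dotv x (M *m x).

Definition posdefmx (R : realType) (n : nat) (M : 'M[R]_n) : Prop :=
  M^T = M /\ forall x : 'cV[R]_n, x != 0 -> 0 < dotv x (M *m x).

Definition divv (R : realType) (n : nat) (t s : 'cV[R]_n) : 'cV[R]_n :=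
  \col_i (t i 0 / s i 0).

Definition is_minimum (R : realType) (E : set R) (m : R) : Prop :=
  E m /\ lbound E m.

Definition is_maximum (R : realType) (E : set R) (m : R) : Prop :=
  E m /\ ubound E m.

Definition global_minimizer (R : realType) (T : Type) (F : T -> R)
    (D : set T) (z : T) : Prop :=
  D z /\ forall w, D w -> F z <= F w.

Definition global_maximizer (R : realType) (T : Type) (F : T -> R)
    (D : set T) (z : T) : Prop :=
  D z /\ forall w, D w -> F w <= F z.

(* A primal point is (x, v) and a dual point is (varsigma, (sigma1, sigma2)).
   Both are notations so that canonical structures are found directly. *)
Notation primal_point R n := ('cV[R]_n * 'cV[R]_n)%type.
Notation dual_point R n := (R * ('cV[R]_n * 'cV[R]_n))%type.

Definition primalP (R : realType) (n : nat) (A B : 'M[R]_n) (alpha : R)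
    (c f : 'cV[R]_n) (z : primal_point R n) : R :=
  let: (x, v) := z in
  2^-1 * dotv x (A *m x) - dotv c x
  + 2^-1 * (2^-1 * dotv x (B *m x) - alpha) ^+ 2 - dotv f v.

Definition chi_v (R : realType) (n : nat) : set (primal_point R n) :=
  [set z : primal_point R n |
           (forall i, z.2 i 0 = 0 \/ z.2 i 0 = 1) /\
           (forall i, - z.2 i 0 <= z.1 i 0 <= z.2 i 0)].

Definition Gmx (R : realType) (n : nat) (A B : 'M[R]_n) (vs : R)
    (s1 : 'cV[R]_n) : 'M[R]_n :=
  A + vs *: B + 2 *: diag_mx s1^T.

Definition Ssharp (R : realType) (n : nat) (A B : 'M[R]_n) (alpha : R) :
    set (dual_point R n) :=
  [set y : dual_point R n |
           [/\ - alpha <= y.1,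
               forall i, 0 <= y.2.1 i 0,
               forall i, 0 < y.2.2 i 0 &
               posdefmx (Gmx A B y.1 y.2.1)]].

(* Meaningful where Gmx is invertible and sigma2 has no zero entry; elsewhere
   invmx and division take their conventional default values. *)
Definition dualPi (R : realType) (n : nat) (A B : 'M[R]_n) (alpha : R)
    (c f : 'cV[R]_n) (y : dual_point R n) : R :=
  let: (vs, (s1, s2)) := y in
  - (2^-1 * dotv c (invmx (Gmx A B vs s1) *m c))
  - 4^-1 * (\sum_(i < n) (f i 0 + s1 i 0 + s2 i 0) ^+ 2 / s2 i 0)
  - 2^-1 * vs ^+ 2 - alpha * vs.

Definition gradient (R : realType) (n : nat) (F : dual_point R n -> R)
    (y : dual_point R n) : dual_point R n :=
  ('D_(1, (0, 0)) F y,
   (\col_i 'D_(0, (delta_mx i 0, 0)) F y,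
    \col_i 'D_(0, (0, delta_mx i 0)) F y)).

(* 'D is a total operator (a limit, arbitrary when it does not exist).  There is
   no differentiability clause: dualPi is smooth near every point of Ssharp. *)
Definition critical_point (R : realType) (n : nat) (F : dual_point R n -> R)
    (y : dual_point R n) : Prop :=
  gradient F y = (0, (0, 0)).

(* Main.v *)
(* For every feasible (x, v) and every (vs, s1, s2) in Ssharp, with
   G = G(vs, s1) and w = (f + s1 + s2) / (2 s2),
     P(x,v) - Pi(vs,s1,s2)
       = 1/2 (1/2 x^T B x - alpha - vs)^2 + 1/2 (x - G^-1 c)^T G (x - G^-1 c)
         + sum_i [s1_i (v_i - x_i^2) + s2_i (v_i - v_i^2) + s2_i (v_i - w_i)^2],
   which is nonnegative because v_i^2 = v_i and x_i^2 <= v_i^2.  At a critical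
   point, with x = G^-1 c and v = w, the three blocks of the gradient equation
   say 1/2 x^T B x = vs + alpha, x_i^2 = v_i and v_i^2 = v_i: hence (x, v) is
   feasible and every term of the gap vanishes. *)
Require Import Defs.
From HB Require Import structures.
From mathcomp Require Import all_boot all_order all_algebra.
From mathcomp Require Import all_classical all_reals all_analysis.
From mathcomp Require Import ring lra.
Set Implicit Arguments.
Unset Strict Implicit.
Unset Printing Implicit Defensive.
Import Order.TTheory GRing.Theory Num.Theory.
Import numFieldNormedType.Exports.
Local Open Scope classical_set_scope.
Local Open Scope ring_scope.

(** * Dot products and positive definite matrices *)

Section DotProduct.
Variables (R : realType) (n : nat).
Implicit Types (u v w : 'cV[R]_n) (M : 'M[R]_n) (a : R).

Lemma dotvE u w : dotv u w = \sum_i u i 0 * w i 0.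
Proof. by rewrite /dotv mxE; apply: eq_bigr => i _; rewrite mxE. Qed.

Lemma dotvC u w : dotv u w = dotv w u.
Proof. by rewrite !dotvE; apply: eq_bigr => i _; rewrite mulrC. Qed.

Lemma dotvDr u v w : dotv u (v + w) = dotv u v + dotv u w.
Proof. by rewrite /dotv mulmxDr mxE. Qed.

Lemma dotvDl u v w : dotv (u + v) w = dotv u w + dotv v w.
Proof. by rewrite dotvC dotvDr !(dotvC w). Qed.

Lemma dotvZr a u w : dotv u (a *: w) = a * dotv u w.
Proof. by rewrite /dotv -scalemxAr mxE. Qed.

Lemma dotvNr u w : dotv u (- w) = - dotv u w.
Proof. by rewrite -scaleN1r dotvZr mulN1r. Qed.

Lemma dotvNl u w : dotv (- u) w = - dotv u w.
Proof. by rewrite dotvC dotvNr dotvC. Qed.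

Lemma dotv_mulmx M u w : dotv u (M *m w) = dotv (M^T *m u) w.
Proof. by rewrite /dotv trmx_mul trmxK mulmxA. Qed.

Lemma dotv_diag u w : dotv w (diag_mx u^T *m w) = \sum_i u i 0 * w i 0 ^+ 2.
Proof.
rewrite dotvE; apply: eq_bigr => i _.
by rewrite mul_diag_mx !mxE expr2 mulrCA.
Qed.

(** A singular [M] has a nonzero row [r] with [r *m M = 0]; by symmetry the quadratic form vanishes
    at [r^T], against positivity. *)
Lemma posdefmx_unit M : posdefmx M -> M \in unitmx.
Proof.
move=> [Msym Mpos]; rewrite unitmxE unitfE; apply/negP => /det0P[r r_neq0 rM0].
have /Mpos : r^T != 0 by rewrite -trmx0 (inj_eq trmx_inj).
by rewrite dotv_mulmx Msym -[M]Msym -trmx_mul rM0 trmx0 dotvC dotvE big1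
  ?ltxx// => i _; rewrite !mxE mulr0.
Qed.

Lemma posdefmx_ge0 M u : posdefmx M -> 0 <= dotv u (M *m u).
Proof.
move=> [_ Mpos]; have [->|/Mpos/ltW//] := eqVneq u 0.
by rewrite mulmx0 dotvE big1// => i _; rewrite mxE mul0r.
Qed.

End DotProduct.

(** * Inverse matrices along a line *)

Section InverseOnLine.
Variables (R : realType) (n : nat) (M N : 'M[R]_n).
Hypothesis M_unit : M \in unitmx.

(** Polynomial entries make the determinant and adjugate of [M + h *: N] polynomial in [h], hence
    continuous. *)
Let line_poly : 'M[{poly R}]_n :=
  map_mx (@polyC R) M + 'X *: map_mx (@polyC R) N.

Let map_line_poly h : map_mx (horner_eval h) line_poly = M + h *: N.
Proof.
by apply/matrixP => i j; rewrite !mxE /horner_eval !hornerE.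
Qed.

Let det_line h : \det (M + h *: N) = (\det line_poly).[h].
Proof. by rewrite -map_line_poly det_map_mx. Qed.

Let det_neq0 : (\det line_poly).[0] != 0.
Proof. by rewrite -det_line scale0r addr0 -unitfE -unitmxE. Qed.

Lemma near_unitmx_line : \forall h \near (0 : R), M + h *: N \in unitmx.
Proof.
have cvg_det : (\det line_poly).[h] @[h --> 0] --> (\det line_poly).[0].
  exact: continuous_horner.
near=> h; rewrite unitmxE unitfE det_line; near: h.
exact: cvgr_neq0 cvg_det det_neq0.
Unshelve. all: by end_near. Qed.

(** By Cramer's rule the inverse is the adjugate over the determinant, so near 0 this is a quotient
    of polynomials in [h], with denominator nonzero at 0. *)
Lemma cvg_dotv_invmx_line (u w : 'cV[R]_n) :
  dotv u (invmx (M + h *: N) *m w) @[h --> 0] --> dotv u (invmx M *m w).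
Proof.
pose p := \sum_i (u i 0)%:P * \sum_j (\adj line_poly) i j * (w j 0)%:P.
have ratE h : M + h *: N \in unitmx ->
    dotv u (invmx (M + h *: N) *m w) = (\det line_poly).[h]^-1 * p.[h].
  move=> h_unit; rewrite /invmx h_unit -scalemxAl dotvZr det_line; congr (_ * _).
  rewrite -map_line_poly -map_mx_adj dotvE horner_sum; apply: eq_bigr => i _.
  rewrite hornerM hornerC mxE horner_sum; congr (_ * _).
  by apply: eq_bigr => j _; rewrite hornerM hornerC mxE.
have M_unit0 : M + 0 *: N \in unitmx by rewrite scale0r addr0.
(* The limit is written as the value at [h = 0], so that [ratE] applies to it too. *)
rewrite -[X in invmx X *m _](addr0 M) -[X in M + X](scale0r N) ratE//.
apply: (@cvg_trans _ ((\det line_poly).[h]^-1 * p.[h] @[h --> 0])).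
  apply: near_eq_cvg; near=> h; rewrite ratE//.
  by near: h; exact: near_unitmx_line.
exact: cvgM (cvgV det_neq0 (@continuous_horner _ _ _))
  (@continuous_horner _ _ _).
Unshelve. all: by end_near. Qed.

(* The resolvent identity
   [(M + h N)^-1 - M^-1 = - h (M + h N)^-1 N M^-1] turns the difference
   quotient into a function covered by [cvg_dotv_invmx_line]. *)
Lemma is_derive_dotv_invmx_line (u w : 'cV[R]_n) :
  is_derive (0 : R) 1 (fun h => dotv u (invmx (M + h *: N) *m w))
    (- dotv u (invmx M *m (N *m (invmx M *m w)))).
Proof.
set g := fun h : R => _.
have quotE h : h != 0 -> M + h *: N \in unitmx ->
    h^-1 *: ((g \o shift 0) (h *: 1) - g 0) =
    - dotv u (invmx (M + h *: N) *m (N *m (invmx M *m w))).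
  move=> h_neq0 h_unit.
  rewrite /g /= addr0 scale0r addr0 -[h *: 1]/(h * 1) mulr1.
  rewrite -dotvNr -dotvDr -[LHS]dotvZr -dotvNr; congr dotv.
  apply: (can_inj (mulKmx h_unit)).
  rewrite -scalemxAr mulmxN mulmxBr !(mulKVmx h_unit) mulmxDl (mulKVmx M_unit).
  rewrite opprD addrA subrr add0r scalerN -scalemxAl scalerA mulVf// scale1r.
  by [].
have cvg_quot : h^-1 *: ((g \o shift 0) (h *: 1) - g 0) @[h --> 0^'] -->
    - dotv u (invmx M *m (N *m (invmx M *m w))).
  apply: (@cvg_trans _
    ((- dotv u (invmx (M + h *: N) *m (N *m (invmx M *m w)))) @[h --> 0^'])).
    apply: near_eq_cvg; near=> h; rewrite quotE//.
      by near: h; exact: nbhs_dnbhs_neq.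
    by near: h; apply: nbhs_dnbhs; exact: near_unitmx_line.
  by apply: cvgN; apply: cvg_within_filter; exact: cvg_dotv_invmx_line.
by split; [exact: cvgP cvg_quot|exact: cvg_lim cvg_quot].
Unshelve. all: by end_near. Qed.

End InverseOnLine.

(** * Scalar derivatives along a line *)

Lemma is_derive_affine (R : realType) (a b : R) :
  is_derive (0 : R) 1 (fun h => a + h * b) b.
Proof.
have -> : (fun h => a + h * b) = cst a + b \*: id.
  by apply/funext => h; rewrite mulrC.
by apply: is_derive_eq; rewrite add0r -[b *: 1]/(b * 1) mulr1.
Qed.

(** Serves for one summand of the dual function: [tau] and [delta] are the rates of change of its
    numerator base [t] and denominator [s]. *)
Lemma is_derive_sqr_div (R : realType) (t tau s delta : R) : s != 0 ->
  is_derive (0 : R) 1 (fun h => (t + h * tau) ^+ 2 / (s + h * delta))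
    (2 * t * tau / s - t ^+ 2 * delta / s ^+ 2).
Proof.
move=> s_neq0.
have s0 : s + 0 * delta != 0 by rewrite mul0r addr0.
have dV := @is_deriveV R (fun h => s + h * delta) 0 _ _ s0
  (is_derive_affine s delta).
have dX := is_deriveX 2 (is_derive_affine t tau).
have dM := is_deriveM dX dV.
apply: (is_derive_eq dM); rewrite /GRing.scale /= !mul0r !addr0 expr1.
rewrite -[X in X * (- _ * _)]/((t + 0 * tau) ^+ 2) mul0r addr0.
by field.
Qed.

(** * Dual gradient, gap identity and weak duality *)

Section Duality.
Variables (R : realType) (n : nat) (A B : 'M[R]_n) (alpha : R).
Variables (c f : 'cV[R]_n).

Section Derivative.
Variables (vs : R) (s1 s2 : 'cV[R]_n).
Hypothesis Gsym : (Gmx A B vs s1)^T = Gmx A B vs s1.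
Hypothesis Gunit : Gmx A B vs s1 \in unitmx.
Hypothesis s2_neq0 : forall i, s2 i 0 != 0.

Let x := invmx (Gmx A B vs s1) *m c.
Let t i := f i 0 + s1 i 0 + s2 i 0.

(** On a line through the base point the dual function is a one-variable function [g],
    differentiated term by term. The arbitrary direction lets one formula give all three gradient
    blocks. *)
Lemma derive_dualPi (a : R) (d1 d2 : 'cV[R]_n) :
  'D_(a, (d1, d2)) (dualPi A B alpha c f) (vs, (s1, s2)) =
  2^-1 * dotv x ((a *: B + 2 *: diag_mx d1^T) *m x)
  - 4^-1 * (\sum_i (2 * t i * (d1 i 0 + d2 i 0) / s2 i 0
                    - t i ^+ 2 * d2 i 0 / s2 i 0 ^+ 2))
  - (vs + alpha) * a.
Proof.
set G := Gmx A B vs s1; set E := a *: B + _.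
pose g h := - 2^-1 * dotv c (invmx (G + h *: E) *m c)
  - 4^-1 * (\sum_i (t i + h * (d1 i 0 + d2 i 0)) ^+ 2 / (s2 i 0 + h * d2 i 0))
  - (2^-1 * (vs + h * a) ^+ 2 + alpha * (vs + h * a)).
have gE h : dualPi A B alpha c f (h *: (a, (d1, d2)) + (vs, (s1, s2))) = g h.
  rewrite /dualPi /g /=.
  have -> : Gmx A B (h *: a + vs) (h *: d1 + s1) = G + h *: E.
    rewrite /G /E /Gmx; apply/matrixP => i j; rewrite !mxE /GRing.scale /=.
    by case: (i == j); rewrite ?mulr1n ?mulr0n; ring.
  rewrite mulNr opprD addrA [h *: a + vs]addrC; congr (_ - _ * _ - _ - _).
  by apply: eq_bigr => i _; rewrite !mxE /t; congr (_ ^+ 2 / _); ring.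
transitivity ('D_1 g 0).
  rewrite /derive; set q := fun h : R => _; set q' := fun h : R => _.
  suff -> : q = q' by [].
  (* The base point is the argument at [h = 0], so [gE] covers both terms of the difference
     quotient. *)
  apply/funext => h; rewrite /q /q' /comp /shift gE -[X in dualPi _ _ _ _ _ X]add0r.
  by rewrite -(scale0r (a, (d1, d2))) gE addr0 -[h *: 1]/(h * 1) mulr1.
have dinv := is_deriveZ (- 2^-1) (is_derive_dotv_invmx_line E Gunit c c).
have dsum := is_deriveZ (4^-1) (is_derive_sum
  (fun i => is_derive_sqr_div (t i) (d1 i 0 + d2 i 0) (d2 i 0) (s2_neq0 i))).
have dsqr := is_deriveZ (2^-1) (is_deriveX 2 (is_derive_affine vs a)).
have dlin := is_deriveZ alpha (is_derive_affine vs a).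
have dg := is_deriveB (is_deriveB dinv dsum) (is_deriveD dsqr dlin).
have -> : g = - 2^-1 \*: (fun h : R => dotv c (invmx (G + h *: E) *m c))
  - 4^-1 \*: (\sum_i (fun h => (t i + h * (d1 i 0 + d2 i 0)) ^+ 2
                          / (s2 i 0 + h * d2 i 0)))
  - (2^-1 \*: ((fun h => vs + h * a) ^+ 2) + alpha \*: (fun h => vs + h * a)).
  by apply/funext => h; rewrite /g /= !fctE /= fct_sumE.
rewrite (@derive_val _ _ _ _ _ _ _ dg) /GRing.scale /= mul0r addr0 expr1.
(* Symmetry of [G] moves one inverse to the left factor: c^T G^-1 E G^-1 c = x^T E x. *)
rewrite [dotv c _]dotv_mulmx trmx_inv Gsym -/G -/x.
by field.
Qed.

Let delta_col0E i j : (delta_mx i 0 : 'cV[R]_n) j 0 = (j == i)%:R.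
Proof. by rewrite mxE eqxx andbT. Qed.

Let zero_colE j : (0 : 'cV[R]_n) j 0 = 0.
Proof. by rewrite mxE. Qed.

(** With w_i = t_i / (2 s2_i), the partial derivatives are 1/2 x^T B x - (vs + alpha), x_i^2 - w_i
    and w_i^2 - w_i. *)
Lemma critical_dualPi :
    critical_point (dualPi A B alpha c f) (vs, (s1, s2)) ->
  [/\ 2^-1 * dotv x (B *m x) = vs + alpha,
      forall i, x i 0 ^+ 2 = t i / (2 * s2 i 0) &
      forall i, (t i / (2 * s2 i 0)) ^+ 2 = t i / (2 * s2 i 0)].
Proof.
rewrite /critical_point /gradient => -[/[!derive_dualPi] Dvs D1 D2]; split.
- move: Dvs; rewrite trmx0 raddf0 scaler0 addr0 scale1r big1 ?mulr0 ?subr0.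
    by move=> /eqP; rewrite mulr1 subr_eq0 => /eqP.
  by move=> i _; rewrite !mxE addr0 !mulr0 !mul0r subrr.
- move=> i; move/matrixP: D1 => /(_ i 0); rewrite mxE [RHS]mxE derive_dualPi.
  rewrite scale0r add0r -scalemxAl dotvZr dotv_diag.
  rewrite (bigD1 i)//= big1; last first.
    by move=> j /negPf ji; rewrite delta_col0E ji mul0r.
  rewrite (bigD1 i)//= big1; last first.
    by move=> j /negPf ji; rewrite !delta_col0E !zero_colE ji addr0 !mulr0 !mul0r subrr.
  rewrite !delta_col0E !zero_colE eqxx mulr1n => D; apply: subr0_eq; apply: etrans D.
  by field.
- move=> i; move/matrixP: D2 => /(_ i 0); rewrite mxE [RHS]mxE derive_dualPi.
  rewrite scale0r add0r trmx0 raddf0 scaler0 mul0mx.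
  rewrite [dotv _ 0]dotvE big1; last first.
    by move=> j _; rewrite zero_colE mulr0.
  rewrite (bigD1 i)//= big1; last first.
    by move=> j /negPf ji; rewrite !delta_col0E !zero_colE ji addr0 !mulr0 !mul0r subrr.
  rewrite !delta_col0E !zero_colE eqxx mulr1n => D; apply: subr0_eq; apply: etrans D.
  by field.
Qed.

(** Completing squares, in [u] around [x] and in each w_i around t_i / (2 s2_i). Arbitrary [u] and
    [w] let it serve both weak duality and the zero gap. *)
Lemma duality_gap (u w : 'cV[R]_n) :
  primalP A B alpha c f (u, w) - dualPi A B alpha c f (vs, (s1, s2)) =
  2^-1 * (2^-1 * dotv u (B *m u) - alpha - vs) ^+ 2
  + 2^-1 * dotv (u - x) (Gmx A B vs s1 *m (u - x))
  + \sum_i (s1 i 0 * (w i 0 - u i 0 ^+ 2) + s2 i 0 * (w i 0 - w i 0 ^+ 2)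
            + s2 i 0 * (w i 0 - t i / (2 * s2 i 0)) ^+ 2).
Proof.
set G := Gmx A B vs s1.
have Gx : G *m x = c by rewrite /x mulKVmx.
have -> : dotv (u - x) (G *m (u - x)) =
    dotv u (G *m u) - 2 * dotv c u + dotv c x.
  rewrite mulmxBr Gx !dotvDl !dotvDr !dotvNl !dotvNr.
  by rewrite [dotv x (G *m u)]dotv_mulmx Gsym Gx ![dotv _ c]dotvC; ring.
(* The diagonal part of [G] gives terms s1_i u_i^2, which cancel against those of the last sum. *)
have -> : dotv u (G *m u) = dotv u (A *m u) + vs * dotv u (B *m u)
    + 2 * \sum_i s1 i 0 * u i 0 ^+ 2.
  by rewrite /G /Gmx !mulmxDl !dotvDr -!scalemxAl !dotvZr dotv_diag.
have -> : \sum_i (s1 i 0 * (w i 0 - u i 0 ^+ 2) + s2 i 0 * (w i 0 - w i 0 ^+ 2)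
      + s2 i 0 * (w i 0 - t i / (2 * s2 i 0)) ^+ 2) =
    - dotv f w - \sum_i s1 i 0 * u i 0 ^+ 2 + 4^-1 * \sum_i t i ^+ 2 / s2 i 0.
  rewrite dotvE mulr_sumr -!sumrN -!big_split /=; apply: eq_bigr => i _.
  by rewrite /t; field.
by rewrite /primalP /dualPi -/G -/x -/t; field.
Qed.

End Derivative.

Lemma weak_duality (z : 'cV[R]_n * 'cV[R]_n) (y : R * ('cV[R]_n * 'cV[R]_n)) :
  @chi_v R n z -> Ssharp A B alpha y ->
  dualPi A B alpha c f y <= primalP A B alpha c f z.
Proof.
case: z y => [u w] [vs [s1 s2]] [/= w01 uw] [/= _ s1_ge0 s2_gt0 Gpos].
rewrite -subr_ge0 duality_gap ?(posdefmx_unit Gpos) ?Gpos.1//; last first.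
  by move=> i; rewrite gt_eqF.
apply: addr_ge0.
  by rewrite addr_ge0// mulr_ge0 ?invr_ge0 ?ler0n ?sqr_ge0 ?posdefmx_ge0.
apply: sumr_ge0 => i _; have /andP[wu uw'] := uw i.
have ww : w i 0 ^+ 2 = w i 0 by case: (w01 i) => ->; rewrite ?expr0n ?expr1n.
(* The box makes both factors of w_i^2 - u_i^2 = (w_i - u_i)(w_i + u_i) nonnegative. *)
have uu : u i 0 ^+ 2 <= w i 0 by rewrite -ww; nra.
rewrite ww subrr mulr0 addr0 addr_ge0// mulr_ge0 ?subr_ge0 ?sqr_ge0//.
exact: ltW.
Qed.

End Duality.

(** * Zero gap and optimality at a critical point *)

Theorem theorem3 (R : realType) (n : nat) (A B : 'M[R]_n) (alpha : R)
    (c f : 'cV[R]_n) (vs : R) (s1 s2 : 'cV[R]_n)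
    (Asym : A^T = A) (Bpsd : possemidefmx B) (alpha_gt0 : 0 < alpha)
    (yS : Ssharp A B alpha (vs, (s1, s2)))
    (ycrit : critical_point (dualPi A B alpha c f) (vs, (s1, s2))) :
  let P := primalP A B alpha c f in
  let Pid := dualPi A B alpha c f in
  let x := invmx (Gmx A B vs s1) *m c in
  let v := 2^-1 *: divv (f + s1 + s2) s2 in
  [/\ global_maximizer Pid (Ssharp A B alpha) (vs, (s1, s2)),
      global_minimizer P (@chi_v R n) (x, v) &
      [/\ is_minimum (P @` @chi_v R n) (P (x, v)),
          is_maximum (Pid @` Ssharp A B alpha) (Pid (vs, (s1, s2))) &
          P (x, v) = Pid (vs, (s1, s2))]].
Proof.
move=> P Pid x v.
have [/= _ s1_ge0 s2_gt0 Gpos] := yS.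
have Gunit := posdefmx_unit Gpos.
have s2_neq0 i : s2 i 0 != 0 by rewrite gt_eqF.
have [xBx xx vv] := critical_dualPi Gpos.1 Gunit s2_neq0 ycrit.
have vE i : v i 0 = (f i 0 + s1 i 0 + s2 i 0) / (2 * s2 i 0).
  by rewrite !mxE; field.
have xvi i : x i 0 ^+ 2 = v i 0 by rewrite vE -xx.
have vvi i : v i 0 ^+ 2 = v i 0 by rewrite vE vv.
have xv_feasible : @chi_v R n (x, v).
  split=> /= i.
    have /eqP : v i 0 * (v i 0 - 1) = 0 by rewrite mulrBr mulr1 -expr2 vvi subrr.
    by rewrite mulf_eq0 subr_eq0 => /orP[]/eqP; [left|right].
  have v_ge0 : 0 <= v i 0 by rewrite -xvi sqr_ge0.
  (* The nonnegative numbers |x_i| and v_i are compared through their squares, both equal to v_i. *)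
  rewrite -ler_norml -(ler_pXn2r (ltn0Sn 1))// ?nnegrE//.
  by rewrite real_normK ?num_real// xvi vvi.
have no_gap : P (x, v) = Pid (vs, (s1, s2)).
  apply/eqP; rewrite -subr_eq0 duality_gap ?Gpos.1// -/x xBx subrr.
  rewrite mulmx0 [dotv 0 _]dotvE big1 => [|i _]; last by rewrite mxE mul0r.
  rewrite big1 => [|i _]; last by rewrite xvi vvi -vE !subrr; ring.
  by apply/eqP; ring.
(* By weak duality the common value lies above every dual value and below every primal one. *)
have ymax y : Ssharp A B alpha y -> Pid y <= Pid (vs, (s1, s2)).
  by move=> yS'; rewrite -no_gap; exact: weak_duality.
have xvmin z : @chi_v R n z -> P (x, v) <= P z.
  by move=> zchi; rewrite no_gap; exact: weak_duality.
split; [by split|by split|split=> //; split].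
- by exists (x, v).
- by move=> _ [z zchi <-]; exact: xvmin.
- by exists (vs, (s1, s2)).
- by move=> _ [y yS' <-]; exact: ymax.
Qed.
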